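(* Let $(V,g)$ be an inner product vector space over $k$, with $k=\mathbb{R}$ or $k=\mathbb{C}$ (possibly infinite-dimensional), and let $\varphi,\psi\in\operatorname{End}_k(V)$ be finite potent endomorphisms with $i(\varphi)\le 1$ and $i(\psi)\le 1$. If $\varphi\leq^{(\#)}\psi$, then $\operatorname{Im}(\varphi)\subseteq\operatorname{Im}(\psi)$ and $\operatorname{Ker}(\psi)\subseteq\operatorname{Ker}(\varphi)$.
   Context: An endomorphism $\varphi$ of $V$ is finite potent if $\varphi^n(V)$ is finite-dimensional for some $n$. Equivalently, there is a (unique) $\varphi$-invariant decomposition $V=W_\varphi\oplus U_\varphi$ (AST-decomposition) with $\varphi|_{U_\varphi}$ nilpotent, $W_\varphi$ finite-dimensional and $\varphi|_{W_\varphi}$ an automorphism of $W_\varphi$. The index $i(\varphi)$ is the nilpotency order of $\varphi|_{U_\varphi}$; $i(\varphi)\le 1$ iff $W_\varphi=\operatorname{Im}(\varphi)$ iff $U_\varphi=\operatorname{Ker}(\varphi)$. For $\varphi$ finite potent with $i(\varphi)\le 1$ one has $V=\operatorname{Im}(\varphi)\oplus[\operatorname{Im}(\varphi)]^{\perp}$, and the core inverse $\varphi^{(\#)}$ is the unique linear map with $\varphi\circ\varphi^{(\#)}=P_{\operatorname{Im}(\varphi)}$ (the orthogonal projection onto $\operatorname{Im}(\varphi)$ induced by this decomposition) and $\operatorname{Im}(\varphi^{(\#)})\subseteq\operatorname{Im}(\varphi)$. For finite potent $\varphi,\psi$ of index $\le1$, the core order $\varphi\leq^{(\#)}\psi$ means: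 $\varphi\circ\varphi^{(\#)}=\psi\circ\varphi^{(\#)}$ and $\varphi^{(\#)}\circ\varphi=\varphi^{(\#)}\circ\psi$. *)

(* Defs.v *)
From HB Require Import structures.
From mathcomp Require Export all_boot all_order all_algebra.
From mathcomp Require Export sesquilinear complex.
From mathcomp Require Export mathcomp_extra boolp classical_sets functions reals.

Set Implicit Arguments.
Unset Strict Implicit.
Unset Printing Implicit Defensive.

Import Order.TTheory GRing.Theory Num.Theory.
Local Open Scope classical_set_scope.
Local Open Scope ring_scope.

(* Subspaces of a possibly infinite-dimensional space V are classical sets
   W : set V satisfying [submod_closed]. *)

Section FinitePotent.
Context {K : fieldType} {V : lmodType K}.

Definition finite_dimensional (W : set V) : Prop :=
  exists (n : nat) (e : 'I_n -> V),
    W = [set v | exists c : 'I_n -> K, v = \sum_(i < n) c i *: e i].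

Definition direct_sum_decomposition (W U : set V) : Prop :=
  [/\ submod_closed [in W], submod_closed [in U], W `&` U = [set 0] &
      forall v, exists w u, [/\ W w, U u & v = w + u]].

Definition ker (phi : V -> V) : set V := phi @^-1` [set 0].

Definition finite_potent (phi : V -> V) : Prop :=
  exists n, finite_dimensional (range (iter n phi)).

Definition vanishes_on (U : set V) (f : V -> V) : Prop :=
  forall u, U u -> f u = 0.

(* Since iter 0 phi = id, the nilpotency order on U = 0 is 0. *)
Definition nilpotency_order (U : set V) (phi : V -> V) (n : nat) : Prop :=
  vanishes_on U (iter n phi) /\
  forall m, vanishes_on U (iter m phi) -> (n <= m)%N.

Definition AST_decomposition (phi : V -> V) (W U : set V) : Prop :=
  [/\ direct_sum_decomposition W U,
      phi @` W `<=` W /\ phi @` U `<=` U,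
      exists n, vanishes_on U (iter n phi),
      finite_dimensional W &
      set_bij W W phi].

(* The AST decomposition exists and is unique when phi is finite potent;
   otherwise there is none and the index takes the junk value 0. *)
Definition potent_index (phi : V -> V) : nat :=
  xget 0%N [set n | exists W U, AST_decomposition phi W U /\
                                nilpotency_order U phi n].

End FinitePotent.

Section CoreInverse.
Context {K : numFieldType} {theta : K -> K} {V : lmodType K}.
Variable g : {dot V for theta}.

Definition orthogonal_complement (W : set V) : set V :=
  [set v | forall w, W w -> g v w = 0].

(* The W-component of v along V = W (+) W^perp (junk value 0 if v does not
   decompose). *)
Definition orthogonal_projection (W : set V) (v : V) : V :=
  xget 0 [set w | W w /\ orthogonal_complement W (v - w)].

(* Junk value 0 when no such linear map exists; there is exactly one when phi
   is finite potent of index at most 1. *)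
Definition core_inverse (phi : V -> V) : V -> V :=
  xget (fun=> 0) [set f : V -> V |
    [/\ linear f,
        phi \o f = orthogonal_projection (range phi) &
        range f `<=` range phi]].

Definition core_le (phi psi : V -> V) : Prop :=
  phi \o core_inverse phi = psi \o core_inverse phi /\
  core_inverse phi \o phi = core_inverse phi \o psi.

End CoreInverse.

(* Main.v *)
Require Import Defs.

Set Implicit Arguments.
Unset Strict Implicit.
Unset Printing Implicit Defensive.

Import Order.TTheory GRing.Theory Num.Theory.
Local Open Scope classical_set_scope.
Local Open Scope ring_scope.

(* Write f for the core inverse of phi and P for the orthogonal projection onto
   Im phi, so that phi f = P.  If y is in Im phi, then y = P y = phi (f y) =
   psi (f y).  If psi v = 0, then f (phi v) = f (psi v) = 0, so
   phi v = P (phi v) = phi (f (phi v)) = 0.  For f to have its defining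
   properties, Im phi must be finite-dimensional and phi bijective on it, which
   follows from the existence of the AST decomposition and i(phi) <= 1. *)

(** * Spans of finite families and linear dependence *)

Section LinearSpan.
Context {K : fieldType} {V : lmodType K}.

Lemma linear_map0 (f : V -> V) : linear f -> f 0 = 0.
Proof. by move=> lf; have := lf (-1) 0 0; rewrite scaler0 addr0 scaleN1r addNr => ->. Qed.

Definition lspan n (e : 'I_n -> V) : set V :=
  [set v | exists c : 'I_n -> K, v = \sum_(i < n) c i *: e i].

(** Since [c k] is invertible, the relation can be solved for [e k], which is then redundant as a
    generator. *)
Lemma lspan_drop n (e : 'I_n.+1 -> V) (c : 'I_n.+1 -> K) (k : 'I_n.+1) :
  c k != 0 -> \sum_i c i *: e i = 0 -> lspan e = lspan (e \o lift k).
Proof.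
move=> ck0 ce0; rewrite (bigD1_ord k) //= in ce0.
have ek : e k = \sum_i (- (c k)^-1 * c (lift k i)) *: e (lift k i).
  under eq_bigr do rewrite -scalerA.
  rewrite -scaler_sumr -[X in _ *: X](addKr (c k *: e k)) ce0 addr0.
  by rewrite scalerN scaleNr opprK scalerA mulVf // scale1r.
apply/seteqP; split=> v [d ->].
  exists (fun i => d k * (- (c k)^-1 * c (lift k i)) + d (lift k i)).
  rewrite (bigD1_ord k) //= ek scaler_sumr -big_split /=.
  by apply: eq_bigr => i _; rewrite scalerDl scalerA.
exists (fun j => if unlift k j is Some i then d i else 0).
rewrite (bigD1_ord k) //= unlift_none scale0r add0r.
by apply: eq_bigr => i _; rewrite liftK.
Qed.

Lemma image_lspan (f : {linear V -> V}) n (e : 'I_n -> V) :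
  f @` lspan e = lspan (f \o e).
Proof.
apply/seteqP; split=> [_ [_ [c ->] <-]|_ [c ->]].
  by exists c; rewrite linear_sum; apply: eq_bigr => i _; rewrite linearZ.
exists (\sum_i c i *: e i); first by exists c.
by rewrite linear_sum; apply: eq_bigr => i _; rewrite linearZ.
Qed.

End LinearSpan.

(** * Existence of the AST decomposition, and the meaning of index at most 1 *)

Section FinitePotent.
Context {K : fieldType} {V : lmodType K} (phi : {linear V -> V}).
Implicit Types (v : V) (n m : nat).

Lemma iter_linear n : linear (iter n phi).
Proof. by elim: n => [|n IH] a u v //; rewrite iterS IH linearP. Qed.

Lemma iter_linear0 n : iter n phi 0 = 0.
Proof. by elim: n => //= n ->; rewrite linear0. Qed.

Lemma range_iterS n : range (iter n.+1 phi) = phi @` range (iter n phi).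
Proof. by rewrite image_comp. Qed.

(* Among all the images of iterates, take one with the fewest generators: its
   generators and their images under [phi] are both linearly independent. *)
Lemma finite_potent_stable_range : finite_potent phi ->
  exists m, finite_dimensional (range (iter m phi)) /\
            set_bij (range (iter m phi)) (range (iter m phi)) phi.
Proof.
move=> [m0 [n0 [e0 E0]]].
pose P n := `[< exists m (e : 'I_n -> V), range (iter m phi) = lspan e >].
have exP : exists n, P n by exists n0; apply/asboolP; exists m0, e0.
case: (ex_minnP exP) => n /asboolP[m [e We]] nmin.
(* A nontrivial relation would let [lspan_drop] remove a generator, against the minimality of [n].
   The exponent [m'] is arbitrary, so this covers both [m] and [m.+1]. *)
have free m' (e' : 'I_n -> V) (c : 'I_n -> K) :
    range (iter m' phi) = lspan e' -> \sum_i c i *: e' i = 0 ->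
    forall i, c i = 0.
  clear We; case: n e e' c nmin => [|n] e e' c nmin We' ce0 k; first by case: k.
  apply/eqP; apply: contraT => ck0; have /nmin : P n; last by rewrite ltnn.
  apply/asboolP; exists m', (e' \o lift k).
  by rewrite We' (lspan_drop ck0 ce0).
have Wfe : range (iter m.+1 phi) = lspan (phi \o e).
  by rewrite range_iterS We image_lspan.
have phiW v : range (iter m phi) v -> range (iter m phi) (phi v).
  by move=> [w _ <-]; exists (phi w) => //; rewrite -iterSr.
(* Applying [phi] gives a relation among the [phi (e i)], which are [n] generators of the next image
   and hence independent. *)
have injW v : range (iter m phi) v -> phi v = 0 -> v = 0.
  rewrite We => -[c ->]; rewrite linear_sum => ce0.
  rewrite big1 // => i _; rewrite (free _ _ c Wfe) ?scale0r //.
  by rewrite -[RHS]ce0; apply: eq_bigr => j _; rewrite linearZ.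
exists m; split; first by exists n, e.
split; first exact: phiW.
  move=> u v; rewrite !inE => -[u' _ <-] [v' _ <-] fuv.
  apply/eqP; rewrite -subr_eq0; apply/eqP/injW; last first.
    by rewrite linearB /= fuv subrr.
  exists (u' - v') => //.
  by rewrite -scaleN1r addrC iter_linear addrC scaleN1r.
have {}/choice[A EA] : forall i, exists c : 'I_n -> K,
    phi (e i) = \sum_j c j *: e j.
  move=> i; suff : lspan e (phi (e i)) by [].
  rewrite -We; apply: phiW; rewrite We; exists (fun j => (i == j)%:R).
  rewrite (bigD1 i) //= eqxx scale1r big1 ?addr0 // => j ji.
  by rewrite eq_sym (negbTE ji) scale0r.
pose M : 'M[K]_n := \matrix_(i, j) A i j.
have sumM (c : 'rV[K]_n) :
    \sum_i c 0 i *: phi (e i) = \sum_j (c *m M) 0 j *: e j.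
  under eq_bigr do rewrite EA scaler_sumr.
  rewrite exchange_big /=; apply: eq_bigr => j _; rewrite mxE scaler_suml.
  by apply: eq_bigr => i _; rewrite mxE scalerA.
(* A row vector killed by [M], the matrix of [phi] in the family [e], would be a relation among the
   [phi (e i)]. *)
have Mu : M \in unitmx.
  rewrite -row_free_unit; apply/inj_row_free => c cM0.
  apply/rowP => i; rewrite mxE (free _ _ (c 0) Wfe) //.
  by rewrite /= sumM cM0 big1 // => j _; rewrite mxE scale0r.
(* Surjectivity: the coordinates of a preimage come from multiplying by the inverse of [M]. *)
rewrite /set_surj -range_iterS Wfe We => _ [c ->].
exists ((\row_j c j *m invmx M) 0); rewrite /= sumM mulmxKV //.
by apply: eq_bigr => j _; rewrite mxE.
Qed.

Lemma range_submod_closed (f : V -> V) : linear f -> submod_closed [in range f].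
Proof.
move=> lf; have f0 := linear_map0 lf.
split; first by rewrite inE /=; exists 0.
by move=> a u v; rewrite !inE => -[u' _ <-] [v' _ <-]; exists (a *: u' + v'); rewrite ?lf.
Qed.

Lemma ker_submod_closed (f : V -> V) : linear f -> submod_closed [in ker f].
Proof.
move=> lf; have f0 := linear_map0 lf.
split; first by rewrite inE.
by move=> a u v; rewrite !inE /ker /= lf => -> ->; rewrite scaler0 addr0.
Qed.

Lemma iter_bij m n (W := range (iter m phi)) :
  set_bij W W phi -> set_bij W W (iter n phi).
Proof.
move=> bij; elim: n => [|n IH]; last exact: set_bij_comp IH bij.
by split=> // v Wv; exists v.
Qed.

(** Fitting's argument: take the image and the kernel of [iter m phi], where [m] is an exponent for
    which [phi] permutes the image. *)
Lemma AST_decomposition_exists : finite_potent phi ->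
  exists W U, AST_decomposition phi W U.
Proof.
move=> /finite_potent_stable_range[m [Wfin bij]].
exists (range (iter m phi)), (ker (iter m phi)).
have [funW injW surjW] := bij; have [_ inj_it surj_it] := iter_bij m bij.
split=> //; last by exists m => u.
- split; first exact/range_submod_closed/iter_linear.
  + exact/ker_submod_closed/iter_linear.
  + apply/seteqP; split=> [v [Wv kv]|_ ->]; last first.
      by split; [exists 0 => //|]; rewrite /ker /= ?iter_linear0.
    apply: inj_it; rewrite ?inE //; last by rewrite iter_linear0.
    by exists 0; rewrite ?iter_linear0.
  (* As [iter m phi] maps W onto itself, some [w] in W has the same image as [v], so [v - w] lies in
     the kernel. *)
  move=> v; have [|w Ww wv] := surj_it (iter m phi v); first by exists v.
  exists w, (v - w); split=> //; last by rewrite addrC subrK.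
  by rewrite /ker /= -scaleN1r addrC iter_linear wv scaleN1r addNr.
- split; first by move=> _ [v Wv <-]; exact: funW.
  move=> _ [v kv <-]; rewrite /ker /= -iterSr /=.
  by rewrite (kv : iter m phi v = 0) linear0.
Qed.

Lemma potent_index_le1 : finite_potent phi -> (potent_index phi <= 1)%N ->
  finite_dimensional (range phi) /\ set_bij (range phi) (range phi) phi.
Proof.
move=> fp; rewrite /potent_index; case: xgetP => [n _ [W [U [AST [vn _]]]] n1|].
  case: AST => -[_ _ _ dec] [phiW _] _ Wfin bij.
  (* Order 0 forces U to be zero, and order 1 says directly that [phi] kills U. *)
  have phiU u : U u -> phi u = 0.
    by move=> /vn; case: n n1 {vn} => [|[]] //= _ ->; rewrite linear0.
  suff -> : range phi = W by [].
  apply/seteqP; split=> [_ [v _ <-]|w Ww].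
    have [w [u [Ww Uu ->]]] := dec v.
    by rewrite linearD /= (phiU _ Uu) addr0; apply: phiW; exists w.
  by case: bij => _ _ /(_ w Ww)[w' _ <-]; exists w'.
(* The default value of the index never occurs: a decomposition exists, and the least exponent
   vanishing on U is a nilpotency order. *)
have [W [U AST]] := AST_decomposition_exists fp.
have [_ _ [n vn] _ _] := AST.
have exv : exists n, `[< vanishes_on U (iter n phi) >] by exists n; apply/asboolP.
case: (ex_minnP exv) => k /asboolP vk kmin /(_ k)[]; exists W, U; split=> //.
by split=> // j /asboolP/kmin.
Qed.

End FinitePotent.

(** * Orthogonal projections and the core inverse *)

Section CoreInverse.
Context {K : numFieldType} {theta : K -> K} {V : lmodType K}.
Variable g : {dot V for theta}.

Lemma dot_eq0 v : g v v = 0 -> v = 0.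
Proof.
move=> gv0; apply/eqP; apply: contraT => v0.
by have := neq0_dnorm_gt0 (s := g) _ v0; rewrite gv0 ltxx.
Qed.

Lemma orthogonal_complement_submod_closed (W : set V) :
  submod_closed [in orthogonal_complement g W].
Proof.
split; first by rewrite inE => w _; rewrite linear0l.
by move=> a u v; rewrite !inE => ou ov w Ww; rewrite linearPl /= ou // ov // mulr0 addr0.
Qed.

(** Gram-Schmidt by induction on the number of generators, which may be dependent. *)
Lemma orthogonal_decomposition_ex (W : set V) : finite_dimensional W ->
  forall v, exists w, W w /\ orthogonal_complement g W (v - w).
Proof.
move=> [n [e ->]] v; elim: n e v => [|n IH] e v.
  exists 0; split; first by exists (fun=> 0); rewrite big_ord0.
  by move=> _ [c ->]; rewrite big_ord0 linear0r.
pose el i := e (lift ord0 i).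
have [p [[cp pE] po]] := IH el (e ord0); have [w [[cw wE] wo]] := IH el v.
(* [d] is the part of the first generator orthogonal to the others, and [a] the coefficient of
   [v - w] along [d]. If [d = 0], the value of [a] is immaterial. *)
pose d := e ord0 - p; pose a := g (v - w) d / g d d.
exists (w + a *: d); split.
  exists (fun i => if unlift ord0 i is Some j then cw j - a * cp j else a).
  rewrite (bigD1_ord ord0) //= unlift_none /d wE pE scalerBr addrCA.
  congr (_ + _); rewrite scaler_sumr -sumrB; apply: eq_bigr => i _.
  by rewrite liftK scalerBl scalerA.
have ad : g (v - w - a *: d) d = 0.
  rewrite linearBl linearZl_LR /= /a; have [->|/eqP dn0] := eqVneq d 0.
    by rewrite !linear0r mulr0 subrr.
  by rewrite divfK ?subrr //; apply/eqP => /dot_eq0.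
have al u : lspan el u -> g (v - w - a *: d) u = 0.
  by move=> elu; rewrite linearBl linearZl_LR /= wo // po // mulr0 subrr.
move=> _ [c ->]; rewrite opprD addrA (bigD1_ord ord0) //=.
have -> : e ord0 = d + p by rewrite subrK.
rewrite [c ord0 *: _]scalerDr -[X in g _ X]addrA linearDr linearZr_LR /= ad mulr0 add0r.
apply: al; exists (fun i => c ord0 * cp i + c (lift ord0 i)).
rewrite pE scaler_sumr -big_split; apply: eq_bigr => i _.
by rewrite scalerDl scalerA.
Qed.

Section Projection.
Variable W : set V.
Hypotheses (Wsub : submod_closed [in W]) (Wfin : finite_dimensional W).

Lemma orthogonal_projection_mem v :
  W (orthogonal_projection g W v) /\
  orthogonal_complement g W (v - orthogonal_projection g W v).
Proof. exact: xgetPex (orthogonal_decomposition_ex Wfin v). Qed.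

(** Two candidates differ by a vector of [W] that is orthogonal to [W], hence to itself. *)
Lemma orthogonal_projection_unique v w :
  W w -> orthogonal_complement g W (v - w) -> orthogonal_projection g W v = w.
Proof.
move=> Ww ow; have [Wp op] := orthogonal_projection_mem v.
set p := orthogonal_projection g W v in Wp op *.
apply/eqP; rewrite -subr_eq0; apply/eqP/dot_eq0.
have Wpw : W (p - w).
  by have := Wsub.2 (-1) w p; rewrite !inE scaleN1r addrC; apply.
have {1}-> : p - w = (v - w) - (v - p) by rewrite opprB [RHS]addrC subrKA.
by rewrite linearBl /= ow // op // subrr.
Qed.

Lemma orthogonal_projection_id w : W w -> orthogonal_projection g W w = w.
Proof.
move=> Ww; apply: orthogonal_projection_unique => //.
by rewrite subrr => u _; rewrite linear0l.
Qed.

Lemma orthogonal_projection_linear : linear (orthogonal_projection g W).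
Proof.
move=> a u v; have [Wu ou] := orthogonal_projection_mem u.
have [Wv ov] := orthogonal_projection_mem v.
apply: orthogonal_projection_unique.
  by have := Wsub.2 a _ _ (mem_set Wu) (mem_set Wv); rewrite inE.
have := (orthogonal_complement_submod_closed W).2 a _ _ (mem_set ou) (mem_set ov).
by rewrite inE scalerBr opprD addrACA.
Qed.

End Projection.

(** A witness is the projection onto the image of [phi] followed by the inverse of [phi] restricted
    to that image; this rules out the default value of [core_inverse]. *)
Lemma core_inverse_spec (phi : {linear V -> V}) :
  finite_potent phi -> (potent_index phi <= 1)%N ->
  [/\ linear (core_inverse g phi),
      phi \o core_inverse g phi = orthogonal_projection g (range phi) &
      range (core_inverse g phi) `<=` range phi].
Proof.
move=> fp /(potent_index_le1 fp)[Wfin [_ inj surj]].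
have Wsub := range_submod_closed (linearP phi).
suff : exists f : V -> V, [/\ linear f,
    phi \o f = orthogonal_projection g (range phi) & range f `<=` range phi].
  exact: (@xgetPex _ (fun=> 0) (fun f => [/\ _, _ & _])).
have /choice[f fP] v : exists w, range phi w /\
    phi w = orthogonal_projection g (range phi) v.
  have [Wp _] := orthogonal_projection_mem Wfin v.
  by have [w Ww wp] := surj _ Wp; exists w.
exists f; split=> [a u v||_ [v _ <-]]; last by have [] := fP v.
  (* Linearity is checked after applying [phi], which is injective on its image, where both sides
     lie. *)
  apply: inj; rewrite ?inE; first by have [] := fP (a *: u + v).
    have := Wsub.2 a _ _ (mem_set (fP u).1) (mem_set (fP v).1).
    by rewrite inE.
  by rewrite linearP /= !(fP _).2 orthogonal_projection_linear.
by apply/funext => v /=; rewrite (fP v).2.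
Qed.

Lemma core_le_range_ker (phi psi : {linear V -> V}) :
  finite_potent phi -> (potent_index phi <= 1)%N -> core_le g phi psi ->
  range phi `<=` range psi /\ ker psi `<=` ker phi.
Proof.
move=> fp ip [fpsi psif]; have [lf phif _] := core_inverse_spec fp ip.
have [Wfin _] := potent_index_le1 fp ip.
have Wsub := range_submod_closed (linearP phi).
have phifK y : range phi y -> phi (core_inverse g phi y) = y.
  by move=> Wy; rewrite -[LHS]/((phi \o _) y) phif orthogonal_projection_id.
split=> [y Wy|v kv].
  exists (core_inverse g phi y) => //; rewrite -[RHS]phifK //.
  by have /= := congr1 (@^~ y) fpsi.
rewrite /ker /= -[LHS]phifK; last by exists v.
have /= -> := congr1 (@^~ v) psif.
by rewrite (kv : psi v = 0) (linear_map0 lf) linear0.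
Qed.

End CoreInverse.

Theorem lemma5p2 (R : realType) :
  (forall (V : lmodType R) (g : {dot V for idfun}) (phi psi : {linear V -> V}),
     finite_potent phi -> finite_potent psi ->
     (potent_index phi <= 1)%N -> (potent_index psi <= 1)%N ->
     core_le g phi psi ->
     range phi `<=` range psi /\ ker psi `<=` ker phi) /\
  (forall (V : lmodType R[i]) (g : {dot V for Num.conj}) (phi psi : {linear V -> V}),
     finite_potent phi -> finite_potent psi ->
     (potent_index phi <= 1)%N -> (potent_index psi <= 1)%N ->
     core_le g phi psi ->
     range phi `<=` range psi /\ ker psi `<=` ker phi).
Proof.
by split=> V g phi psi fphi _ iphi _; exact: core_le_range_ker.
Qed.
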